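(* Assume that (H1) holds. Then for any $(y_0,w_0)\in\mathcal{D}\times\mathbb{R}^n$ there exists $\delta>0$ such that over the time interval $[t_0,t_0+\delta]$ the system of integral equations $$y(t)=y_0+\int_{t_0}^{t}\big[w(s)+A_u(y(s),s)\big]\,ds,$$ $$w(t)=w_0+\int_{t_0}^{t}\Big[-\mu\,w(s)-M_u(y(s),s)w(s)-\kappa\mu^{1/2}\frac{w(s)}{\sqrt{t-s}}+B_u(y(s),s)\Big]\,ds$$ has a unique (continuous) solution $(y,w):[t_0,t_0+\delta]\to\mathcal{D}\times\mathbb{R}^n$ with $(y(t_0),w(t_0))=(y_0,w_0)$. As a consequence, $y(t)$ is a mild solution of the Maxey--Riley equation.
   Context: Let $n\in\{2,3\}$, let $\mathcal{D}\subseteq\mathbb{R}^n$ be open, $\mathbb{R}^+=[0,\infty)$, $t_0\in\mathbb{R}^+$, and let $u:\mathcal{D}\times\mathbb{R}^+\to\mathbb{R}^n$, $u=u(x,t)$, be a fluid velocity field. Let $R=\frac{2\rho_f}{\rho_f+2\rho_p}$, $\mu=R/\mathrm{St}$, $\kappa=\sqrt{9R/(2\pi)}$, $\gamma=\frac{9R}{2\mathrm{Re}}$ be positive constants (with densities $\rho_f,\rho_p>0$ and Stokes and Reynolds numbers $\mathrm{St},\mathrm{Re}>0$), and let $g\in\mathbb{R}^n$ be a constant vector. Write $(\nabla f)_{ij}=\partial f_i/\partial x_j$ for the spatial Jacobian of a vector field $f$, $\Delta$ for the componentwise spatial Laplacian, and $\frac{D}{Dt}=\partial_t+u\cdot\nabla$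 for the material derivative. Define on $\mathcal{D}\times\mathbb{R}^+$: $$A_u=u+\frac{\gamma}{6}\mu^{-1}\Delta u,\qquad M_u=\nabla u+\frac{\gamma}{6}\mu^{-1}\nabla\Delta u,$$ $$B_u=\Big(\frac{3R}{2}-1\Big)\Big(\frac{Du}{Dt}-g\Big)+\Big(\frac{R}{20}-\frac16\Big)\gamma\mu^{-1}\frac{D}{Dt}\Delta u-\frac{\gamma}{6}\mu^{-1}\Big[\nabla u+\frac{\gamma}{6}\mu^{-1}\nabla\Delta u\Big]\Delta u .$$ Assumption (H1): $u(x,t)$ is three times continuously differentiable in its arguments over $\mathcal{D}\times\mathbb{R}^+$, and its partial derivatives (including mixed partials) are uniformly bounded and Lipschitz continuous up to order three (order zero, i.e. $u$ itself, included). The Maxey--Riley equation, written in terms of the particle position $y$ and $w(t)=\dot y(t)-A_u(y(t),t)$, is $$\dot y=w+A_u(y,t),\qquad \dot w=-\mu w-M_u(y,t)w-\kappa\mu^{1/2}\frac{d}{dt}\int_{t_0}^{t}\frac{w(s)}{\sqrt{t-s}}\,ds+B_u(y,t),$$ with $y(t_0)=y_0$, $w(t_0)=w_0$. A mild solution of the Maxey--Riley equation is a (continuous) function $(y(t),w(t))$ satisfying the integral equations displayed in the claim; its component $y$ is then also called a mild solution. *)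

(* Defs.v *)
From HB Require Import structures.
From mathcomp Require Export all_boot all_order all_algebra.
From mathcomp Require Export all_classical all_reals all_analysis.

Set Implicit Arguments.
Unset Strict Implicit.
Unset Printing Implicit Defensive.

Export Order.TTheory GRing.Theory Num.Theory.
Export numFieldNormedType.Exports.

Local Open Scope classical_set_scope.
Local Open Scope ring_scope.

(** Fields on space-time.  A point is [z = (x, t)]; fields are total functions,
    but only their values on [spacetime D] = D x [0, +oo[ are ever used. *)

Definition spacetime (K : realType) (n : nat) (D : set 'cV[K]_n) :
    set ('cV[K]_n * K) :=
  D `*` [set t | 0 <= t].

(** Spatial partial derivatives are the library's directional derivatives: for
    an open [D] they only involve values on [spacetime D], also at t = 0.  The
    time increment is restricted to [0 <= t + h], so that the time derivative is
    the usual two-sided one for t > 0 and the right derivative at t = 0. *)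

Definition dir_x (K : realType) (n : nat) (j : 'I_n) : 'cV[K]_n * K :=
  (delta_mx j 0, 0).

Definition time_quotient (K : realType) (n : nat)
    (f : 'cV[K]_n * K -> 'cV[K]_n) (z : 'cV[K]_n * K) (h : K) : 'cV[K]_n :=
  h^-1 *: (f (z.1, z.2 + h) - f z).

Definition time_increments (K : realType) (t : K) : set_system K :=
  within [set h | 0 <= t + h] 0^'.

(** Coordinates of space-time are indexed by [option 'I_n]:
    [Some j] stands for x_j and [None] for t. *)

Definition partial (K : realType) (n : nat) (i : option 'I_n)
    (f : 'cV[K]_n * K -> 'cV[K]_n) (z : 'cV[K]_n * K) : 'cV[K]_n :=
  match i with
  | Some j => 'D_(dir_x K j) f z
  | None => lim (time_quotient f z @ time_increments z.2)
  end.

Definition has_partial (K : realType) (n : nat) (i : option 'I_n)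
    (f : 'cV[K]_n * K -> 'cV[K]_n) (z : 'cV[K]_n * K) : Prop :=
  match i with
  | Some j => derivable f z (dir_x K j)
  | None => cvg (time_quotient f z @ time_increments z.2)
  end.

Definition partials (K : realType) (n : nat) (s : seq (option 'I_n))
    (f : 'cV[K]_n * K -> 'cV[K]_n) : 'cV[K]_n * K -> 'cV[K]_n :=
  foldr (fun i F => partial i F) f s.

Definition continuously_differentiable (K : realType) (n : nat)
    (D : set 'cV[K]_n) (k : nat) (f : 'cV[K]_n * K -> 'cV[K]_n) : Prop :=
  (forall s i z, (size s < k)%N -> spacetime D z ->
     has_partial i (partials s f) z) /\
  (forall s, (size s <= k)%N ->
     {within spacetime D, continuous (partials s f)}).

Definition regular_velocity (K : realType) (n : nat) (D : set 'cV[K]_n)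
    (u : 'cV[K]_n * K -> 'cV[K]_n) : Prop :=
  continuously_differentiable D 3 u /\
  (forall s, (size s <= 3)%N ->
     [bounded partials s u z | z in spacetime D] /\
     [lipschitz partials s u z | z in spacetime D]).

(** The column convention gives [jacobian f z i j = d f_i / d x_j], and
    (u . nabla) f = [jacobian f *m u]. *)

Definition jacobian (K : realType) (n : nat)
    (f : 'cV[K]_n * K -> 'cV[K]_n) (z : 'cV[K]_n * K) : 'M[K]_n :=
  \matrix_(i, j) partial (Some j) f z i 0.

Definition laplacian (K : realType) (n : nat)
    (f : 'cV[K]_n * K -> 'cV[K]_n) (z : 'cV[K]_n * K) : 'cV[K]_n :=
  \sum_(j < n) partial (Some j) (partial (Some j) f) z.

Definition material (K : realType) (n : nat)
    (u f : 'cV[K]_n * K -> 'cV[K]_n) (z : 'cV[K]_n * K) : 'cV[K]_n :=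
  partial None f z + jacobian f z *m u z.

Record mr_params (K : realType) (n : nat) := MRParams {
  rho_f : K; rho_p : K; Stokes : K; Reynolds : K;
  gravity : 'cV[K]_n
}.

Section Coefficients.
Context (K : realType) (n : nat) (p : mr_params K n).
Context (u : 'cV[K]_n * K -> 'cV[K]_n).

Definition mr_R : K := 2 * rho_f p / (rho_f p + 2 * rho_p p).
Definition mr_mu : K := mr_R / Stokes p.
Definition mr_kappa : K := Num.sqrt (9 * mr_R / (2 * pi)).
Definition mr_gamma : K := 9 * mr_R / (2 * Reynolds p).

Definition A_u (z : 'cV[K]_n * K) : 'cV[K]_n :=
  u z + (mr_gamma / 6 * mr_mu^-1) *: laplacian u z.

Definition M_u (z : 'cV[K]_n * K) : 'M[K]_n :=
  jacobian u z + (mr_gamma / 6 * mr_mu^-1) *: jacobian (laplacian u) z.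

Definition B_u (z : 'cV[K]_n * K) : 'cV[K]_n :=
  (3 * mr_R / 2 - 1) *: (material u u z - gravity p)
  + ((mr_R / 20 - 1 / 6) * mr_gamma * mr_mu^-1) *: material u (laplacian u) z
  - (mr_gamma / 6 * mr_mu^-1) *:
      ((jacobian u z + (mr_gamma / 6 * mr_mu^-1) *: jacobian (laplacian u) z)
        *m laplacian u z).

End Coefficients.

(** Componentwise Lebesgue integral over [a, b]. *)
Definition vint (K : realType) (n : nat) (a b : K) (f : K -> 'cV[K]_n) :
    'cV[K]_n :=
  \col_i (\int[@lebesgue_measure K]_(s in `[a, b]) f s i 0).

(** The Maxey--Riley equation with [w = y' - A_u (y, t)] is
      w' = - mu w - M_u w - kappa mu^(1/2) d/dt int_t0^t w(s)/sqrt(t-s) ds + B_u;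
    a mild solution satisfies its time-integrated form.  At [s = t] the kernel is
    [0^-1 = 0], which affects a null set only.  When [regular_velocity D u] holds and [y], [w]
    are continuous with [y] in [D], all the integrands are integrable. *)
Definition mild_solution (K : realType) (n : nat) (p : mr_params K n)
    (D : set 'cV[K]_n) (u : 'cV[K]_n * K -> 'cV[K]_n)
    (t0 delta : K) (y0 w0 : 'cV[K]_n) (y w : K -> 'cV[K]_n) : Prop :=
  [/\ {within `[t0, t0 + delta], continuous y},
      {within `[t0, t0 + delta], continuous w},
      (forall t, t0 <= t <= t0 + delta -> D (y t)),
      (forall t, t0 <= t <= t0 + delta ->
         y t = y0 + vint t0 t (fun s => w s + A_u p u (y s, s)))
    & (forall t, t0 <= t <= t0 + delta ->
         w t = w0 + vint t0 t (fun s =>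
           - (mr_mu p *: w s) - M_u p u (y s, s) *m w s
           - (mr_kappa p * Num.sqrt (mr_mu p) / Num.sqrt (t - s)) *: w s
           + B_u p u (y s, s)))].

Definition mild_position (K : realType) (n : nat) (p : mr_params K n)
    (D : set 'cV[K]_n) (u : 'cV[K]_n * K -> 'cV[K]_n)
    (t0 delta : K) (y0 w0 : 'cV[K]_n) (y : K -> 'cV[K]_n) : Prop :=
  exists w, mild_solution p D u t0 delta y0 w0 y w.

(* Main.v *)
Require Import Defs.
From mathcomp Require Import ring lra measurable_realfun.

(** The mild system is a Volterra equation of the second kind for the phase
    variable [x = (y, w)],

      [x(t) = x0 + int_t0^t (f(x(s), s) + (t - s)^(-1/2) g(x(s), s)) ds],

    whose kernel has an integrable singularity. The Picard map of such an
    equation is a contraction on short intervals for the same reason as for an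
    ordinary differential equation: the integral of [1 + (t - s)^(-1/2)] over an
    interval of length [d] is at most [d + 2 sqrt d] ([norm_abel_integral_le]), and
    this tends to 0 with [d]. Hence the map preserves the continuous functions
    with values in a small ball around [x0] and halves their distances
    ([volterra_map_in_ball], [volterra_map_contraction]); its iterates converge
    uniformly to a solution. Continuity in time of the singular integral is
    quantitative: the kernel being decreasing in time, its L1 variation between
    [t] and [t'] is computed exactly ([abel_integral_modulus]).

    Uniqueness is claimed among all solutions with [y] in [D], not only those
    staying in the ball. It follows on the same interval because the Lipschitz
    estimate compares a state of the ball with an arbitrary state
    ([admissible_field], [volterra_short_unique], [volterra_wellposed]).

    For the Maxey--Riley equation the estimates reduce to the fact that [A_u],
    [M_u] and [B_u] are bounded and Lipschitz on space-time. They are sums and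
    products of partial derivatives of [u] of order at most three; the
    derivatives of the Laplacian have to be recognized as such ([partial_sum]).
    The only term that is not globally Lipschitz is [M_u(y, s) w], bilinear in a
    bounded factor and in [w], and [w] is bounded on the ball
    ([mr_drift_admissible]). *)

Set Implicit Arguments.
Unset Strict Implicit.
Unset Printing Implicit Defensive.

Local Open Scope classical_set_scope.
Local Open Scope ring_scope.

(** * The Abel kernel *)

(** Square root and inverse being total, the kernel vanishes for [r <= 0]: this
    is the causal kernel, with value 0 at its singularity. *)
Definition abel_kernel (K : realType) (r : K) : K := (Num.sqrt r)^-1.

Section AbelKernel.
Context (K : realType).
Implicit Types (a b t s r : K).
Local Notation leb := (@lebesgue_measure K).
Local Notation k := (@abel_kernel K).

Lemma abel_kernel_ge0 r : 0 <= k r.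
Proof. by rewrite invr_ge0 sqrtr_ge0. Qed.

(** Real powers are measurable, and the inverse is the power -1 on nonnegative
    numbers. *)
Lemma measurable_abel_kernel t (A : set K) :
  measurable_fun A (fun s => k (t - s)).
Proof.
have -> : (fun s => k (t - s)) = (fun s => Num.sqrt (t - s) `^ (-1)).
  by apply/funext => s; rewrite powR_inv1// sqrtr_ge0.
apply: measurable_funTS.
apply: (measurableT_comp (measurable_powR (-1))).
apply: continuous_measurable_fun => s.
apply: continuous_comp; last exact: sqrt_continuous.
by apply: continuousB; [exact: cst_continuous|exact: cvg_id].
Qed.

Lemma itvco_bigcup a t : a < t ->
  \bigcup_i `[a, t - (t - a) / i.+1%:R]%classic = `[a, t[%classic.
Proof.
move=> at_; apply/seteqP; split=> [x [i _]|x] /=; rewrite !in_itv/=.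
  move=> /andP[-> /le_lt_trans]; apply.
  by rewrite ltrBlDr ltrDl divr_gt0// subr_gt0.
move=> /andP[ax xt]; exists (Num.truncn ((t - a) / (t - x))) => //=.
rewrite in_itv/= ax/= lerBrDl -lerBrDr ler_pdivrMr//.
by rewrite mulrC -ler_pdivrMr ?subr_gt0// ltW// truncnS_gt.
Qed.

(** Away from the singularity the kernel is continuous, with primitive
    [- 2 sqrt (t - s)]. *)
Lemma integral_abel_kernel_lt a b t : a <= b -> b < t ->
  (\int[leb]_(s in `[a, b]) (k (t - s))%:E =
   (2 * (Num.sqrt (t - a) - Num.sqrt (t - b)))%:E)%E.
Proof.
rewrite le_eqVlt => /predU1P[->|ab] bt.
  by rewrite set_itv1 integral_set1 subrr mulr0.
have tsd s : s < t -> is_derive s 1 (fun s => - 2 * Num.sqrt (t - s)) (k (t - s)).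
  move=> st.
  have ts0 : 0 < t - s by rewrite subr_gt0.
  have d1 : is_derive s 1 (fun s : K => t - s) (-1).
    rewrite -[X in is_derive _ _ _ X]add0r.
    exact: is_deriveB.
  have d2 := @is_derive1_comp K Num.sqrt (fun s => t - s) s
       ((2 * Num.sqrt (t - s))^-1) (-1) (is_derive1_sqrt ts0) d1.
  have d3 := @is_deriveZ _ _ _ (Num.sqrt \o (fun s => t - s)) (-2) s 1 _ d2.
  apply: (is_derive_eq d3).
  rewrite /abel_kernel /GRing.scale/= invfM; field.
  by rewrite gt_eqF// sqrtr_gt0.
have tsc s : s < t -> {for s, continuous (fun s => - 2 * Num.sqrt (t - s))}.
  move=> /tsd[d _]; exact/differentiable_continuous/derivable1_diffP.
have E : 2 * (Num.sqrt (t - a) - Num.sqrt (t - b))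
   = (- 2 * Num.sqrt (t - b)) - (- 2 * Num.sqrt (t - a)) by ring.
rewrite E EFinB.
apply: (@continuous_FTC2 _ (fun s => k (t - s)) (fun s => - 2 * Num.sqrt (t - s)) a b) => //.
- apply: continuous_in_subspaceT => s; rewrite inE/= in_itv/= => /andP[_ sb].
  have ts0 : 0 < t - s by rewrite subr_gt0 (le_lt_trans sb).
  apply: (@continuousV _ _ (fun s => Num.sqrt (t - s))); first by rewrite gt_eqF// sqrtr_gt0.
  apply: (@continuous_comp _ _ _ (fun s : K => t - s) Num.sqrt); last exact: sqrt_continuous.
  by apply: continuousB; [exact: cst_continuous|exact: cvg_id].
- split.
  + move=> x; rewrite in_itv/= => /andP[_ xb].
    by have [] := tsd x (lt_trans xb bt).
  + exact/cvg_at_right_filter/(tsc a (lt_trans ab bt)).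
  + exact/cvg_at_left_filter/(tsc b bt).
- move=> x; rewrite in_itv/= => /andP[_ xb].
  by rewrite derive1E; have [_ ->] := tsd x (lt_trans xb bt).
Qed.

(** The endpoint [b = t] is reached by monotone convergence along the intervals
    [[a, t - (t - a) / (i + 1)]], which exhaust [[a, t[]. *)
Lemma integral_abel_kernel a b t : a <= b <= t ->
  (\int[leb]_(s in `[a, b]) (k (t - s))%:E =
   (2 * (Num.sqrt (t - a) - Num.sqrt (t - b)))%:E)%E.
Proof.
move=> /andP[ab]; rewrite le_eqVlt => /predU1P[bt|]; last exact: integral_abel_kernel_lt.
move: ab; rewrite bt le_eqVlt => /predU1P[->|at_].
  by rewrite set_itv1 integral_set1 subrr mulr0.
rewrite subrr sqrtr0 subr0 -integral_itv_bndo_bndc; last first.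
  apply/measurable_EFinP; exact: measurable_abel_kernel.
rewrite -itvco_bigcup//.
pose c i := t - (t - a) / i.+1%:R.
have ta0 : 0 < t - a by rewrite subr_gt0.
have ic i : ((t - a) / i.+1%:R <= t - a).
  by rewrite ler_pdivrMr// ler_peMr ?(ltW ta0)// ler1n.
have H1 := @ge0_nondecreasing_set_cvg_integral _ (measurableTypeR K) K
   (fun i => `[a, c i]%classic) (fun s => (k (t - s))%:E) leb.
apply: (cvg_unique _ (H1 _ _ _ _)) => //.
- apply/nondecreasing_seqP => i; rewrite subsetEset; apply: subset_itvl.
  rewrite bnd_simp lerB// ler_pM2l// lef_pV2 ?posrE// ler_nat//.
- by move=> i; apply/measurable_EFinP; exact: measurable_abel_kernel.
- by move=> i x _; rewrite lee_fin abel_kernel_ge0.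
have -> : (fun i => (\int[leb]_(s in `[a, c i]) (k (t - s))%:E)%E)
  = (fun i => (2 * (Num.sqrt (t - a) - Num.sqrt ((t - a) * harmonic i)))%:E).
  apply/funext => i; rewrite integral_abel_kernel_lt//.
  - by rewrite /c opprB addrCA subrr addr0.
  - by rewrite /c lerBrDl -lerBrDr.
  - by rewrite /c ltrBlDr ltrDl divr_gt0.
have h0 : (t - a) * harmonic i @[i --> \oo] --> (0 : K).
  have -> : (0 : K) = (t - a) * 0 by rewrite mulr0.
  by apply: cvgMl_tmp; exact: cvg_harmonic.
have h1 : Num.sqrt ((t - a) * harmonic i) @[i --> \oo] --> (0 : K).
  by rewrite -(sqrtr0 K); apply: (cvg_comp _ _ h0); exact: sqrt_continuous.
apply: cvg_EFin; first by apply: nearW.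
have -> : 2 * Num.sqrt (t - a) = 2 * (Num.sqrt (t - a) - 0) by rewrite subr0.
apply: cvgMl_tmp; exact: (cvgB (cvg_cst (Num.sqrt (t - a))) h1).
Qed.

Lemma integrable_abel_kernel a b t : b <= t ->
  leb.-integrable `[a, b] (EFin \o (fun s => k (t - s))).
Proof.
move=> bt; have [ab|ba] := leP a b; last first.
  by rewrite set_itv_ge -?leNgt ?bnd_simp -?ltNge//; exact: integrable_set0.
apply/integrableP; split.
  by apply/measurable_EFinP; exact: measurable_abel_kernel.
under eq_integral do rewrite /= ger0_norm ?abel_kernel_ge0//.
by rewrite integral_abel_kernel ?ab ?ltry.
Qed.

Lemma Rintegral_abel_kernel a b t : a <= b <= t ->
  \int[leb]_(s in `[a, b]) k (t - s) = 2 * (Num.sqrt (t - a) - Num.sqrt (t - b)).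
Proof. by move=> abt; rewrite /Rintegral integral_abel_kernel. Qed.
End AbelKernel.

(** * Integrals of vector-valued functions *)
Lemma mx_norm_leP (K : realType) (m n : nat) (A : 'M[K]_(m, n)) (c : K) :
  0 <= c -> (`|A| <= c) <-> (forall i j, `|A i j| <= c).
Proof.
move=> c0; rewrite [`|A|]/Num.Def.normr /= mx_normrE; split.
  by move=> /bigmax_leP[_ H] i j; exact: (H (i, j)).
by move=> H; apply/bigmax_leP; split => // -[i j] _.
Qed.

Lemma mx_coord_le (K : realType) (m n : nat) (A : 'M[K]_(m, n)) i j :
  `|A i j| <= `|A|.
Proof. by have /mx_norm_leP -> := lexx `|A|. Qed.

Lemma sqrtr_subadd (K : realType) (x y : K) : 0 <= x -> 0 <= y ->
  Num.sqrt (x + y) <= Num.sqrt x + Num.sqrt y.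
Proof.
move=> x0 y0; rewrite -[leRHS]ger0_norm ?addr_ge0 ?sqrtr_ge0// -sqrtr_sqr.
rewrite ler_sqrt ?sqr_ge0// sqrrD !sqr_sqrtr// -addrA [_ *+ 2 + _]addrC addrA lerDl.
by rewrite mulrn_wge0// mulr_ge0// sqrtr_ge0.
Qed.

Section VectorIntegral.
Context (K : realType) (m : nat).
Local Notation leb := (@lebesgue_measure K).
Local Notation k := (@abel_kernel K).
Implicit Types (f g h : K -> 'cV[K]_m) (a b c t : K).

Definition vintegrable a b f :=
  forall i, leb.-integrable `[a, b] (EFin \o (fun s => f s i 0)).

Lemma vintegrableB a b f g : vintegrable a b f -> vintegrable a b g ->
  vintegrable a b (fun s => f s - g s).
Proof.
move=> F G i; apply: eq_integrable (integrableB _ (F i) (G i)) => //.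
by move=> s _ /=; rewrite !mxE EFinB.
Qed.

Lemma eq_vint a b f g : (forall s, a <= s <= b -> f s = g s) ->
  vint a b f = vint a b g.
Proof.
move=> fg; apply/matrixP => i j; rewrite !mxE; apply: eq_Rintegral => s.
by rewrite inE/= in_itv/= => /fg ->.
Qed.

Lemma vintB a b f g : vintegrable a b f -> vintegrable a b g ->
  vint a b (fun s => f s - g s) = vint a b f - vint a b g.
Proof.
move=> F G; apply/matrixP => i j; rewrite !mxE -RintegralB//.
by apply: eq_Rintegral => s _; rewrite !mxE.
Qed.

Lemma vint_split a c b f : a <= c <= b -> vintegrable a b f ->
  vint a b f = vint a c f + vint c b f.
Proof.
move=> /andP[ac cb] F; apply/matrixP => i j; rewrite !mxE.
have Fcb : leb.-integrable `]c, b] (EFin \o (fun s => f s i 0)).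
  by apply: (integrableS _ _ _ (F i)) => //; apply: subset_itv; rewrite bnd_simp.
have E1 := Rintegral_itv_obnd_cbnd Fcb.
have E2 := @Rintegral_itvB K _ _ _ c (F i).
by rewrite -[X in _ = _ + X]E1 -[X in _ = _ + X]E2 ?bnd_simp// addrC subrK.
Qed.

(** The pointwise bound is asked on [[a, b[] only: the comparison of two Abel
    kernels [k (t' - s) <= k (t - s)] fails at the point [s = t], where the right
    hand side is 0. *)
Lemma norm_vint_le a b f (h : K -> K) : a <= b -> vintegrable a b f ->
  leb.-integrable `[a, b] (EFin \o h) ->
  (forall s, a <= s < b -> `|f s| <= h s) ->
  `|vint a b f| <= \int[leb]_(s in `[a, b]) h s.
Proof.
move=> ab F H fh.
have sub : `[a, b[ `<=` `[a, b] by apply: subset_itvl; rewrite bnd_simp.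
have Ho : leb.-integrable `[a, b[ (EFin \o h) by exact: integrableS H.
have Fo i : leb.-integrable `[a, b[ (EFin \o (fun s => f s i 0)) by exact: integrableS (F i).
rewrite -Rintegral_itv_bndo_bndc//.
have h0 : 0 <= \int[leb]_(s in `[a, b[) h s.
  by apply: Rintegral_ge0 => s /=; rewrite in_itv/= => /fh; exact: le_trans.
apply/mx_norm_leP => // i j; rewrite mxE.
rewrite -Rintegral_itv_bndo_bndc//.
apply: le_trans (le_normr_Rintegral _ (Fo i)) _ => //.
apply: le_Rintegral => //; first exact: integrable_norm.
move=> s; rewrite /= in_itv/= => /fh; exact/le_trans/mx_coord_le.
Qed.

Lemma continuous_coord (A : set K) f i : {within A, continuous f} ->
  {within A, continuous (fun s => f s i 0)}.
Proof.
move=> cf s; apply: (@continuous_comp (subspace A) _ _ f (fun B : 'cV[K]_m => B i 0)).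
  exact: cf.
exact: coord_continuous.
Qed.

Lemma continuous_vintegrable a b f : {within `[a, b], continuous f} ->
  vintegrable a b f.
Proof.
move=> cf i; apply: continuous_compact_integrable; first exact: segment_compact.
exact: continuous_coord.
Qed.

(** A continuous function on a segment is bounded and measurable, hence may
    multiply the integrable kernel. *)
Lemma abel_vintegrable a b t f : b <= t -> {within `[a, b], continuous f} ->
  vintegrable a b (fun s => k (t - s) *: f s).
Proof.
move=> bt cf i.
have ci := @continuous_coord _ _ i cf.
have bi : [bounded f s i 0 | s in `[a, b]%classic].
  have /compact_bounded[M [Mr HM]] := continuous_compact ci (@segment_compact K a b).
  by exists M; split => // x Mx s sab /=; apply: HM => //; exists s.
have mi : measurable_fun (`[a, b] : set (measurableTypeR K)) (fun s => f s i 0).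
  by apply: subspace_continuous_measurable_fun.
have := @integrableMr _ (measurableTypeR K) K leb _ (measurable_itv _)
  (fun s => f s i 0) _ mi bi (integrable_abel_kernel a bt).
apply: eq_integrable => //.
by move=> s _ /=; rewrite !mxE mulrC EFinM.
Qed.
End VectorIntegral.

(** * The Abel integral operator *)
Section AbelOperator.
Context (K : realType) (m : nat).
Local Notation leb := (@lebesgue_measure K).
Local Notation k := (@abel_kernel K).
Implicit Types (f g phi psi : K -> 'cV[K]_m) (a b c t : K).

Lemma vintegrableD a b f g : vintegrable a b f -> vintegrable a b g ->
  vintegrable a b (fun s => f s + g s).
Proof.
move=> F G i; apply: eq_integrable (integrableD _ (F i) (G i)) => //.
by move=> s _ /=; rewrite !mxE EFinD.
Qed.

Definition abel_integral phi psi a t : 'cV[K]_m :=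
  vint a t (fun s => phi s + k (t - s) *: psi s).

Lemma abel_integrand_vintegrable phi psi a b t : b <= t ->
  {within `[a, b], continuous phi} -> {within `[a, b], continuous psi} ->
  vintegrable a b (fun s => phi s + k (t - s) *: psi s).
Proof.
move=> bt cphi cpsi.
apply: vintegrableD; first exact: continuous_vintegrable.
exact: abel_vintegrable.
Qed.

(** The integral of [1 + 1 / sqrt r] over [[0, d]]. *)
Definition abel_modulus (d : K) : K := d + 2 * Num.sqrt d.

Lemma abel_modulus_le d e : d <= e -> abel_modulus d <= abel_modulus e.
Proof. by move=> de; rewrite lerD// ler_pM2l// ler_wsqrtr. Qed.

Lemma Rintegral_cst_itv a b c : a <= b ->
  \int[leb]_(s in `[a, b]) c = c * (b - a).
Proof.
move=> ab; rewrite Rintegral_cst//= lebesgue_measure_itv/= lte_fin.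
by case: ltgtP ab => //= -> _; rewrite subrr.
Qed.

Lemma integrable_cst_itv a b c : leb.-integrable `[a, b] (EFin \o cst c).
Proof.
apply: continuous_compact_integrable; first exact: segment_compact.
by apply: continuous_subspaceT => s; exact: cst_continuous.
Qed.

(** This bound is behind both the invariance of a ball and the contraction: the
    kernel contributes [2 (sqrt (t - a) - sqrt (t - b)) <= 2 sqrt (b - a)], by
    subadditivity of the square root, so that the operator is small on short
    intervals in spite of the singularity. *)
Lemma norm_abel_integral_le phi psi a b t C : a <= b <= t ->
  {within `[a, b], continuous phi} -> {within `[a, b], continuous psi} ->
  (forall s, a <= s <= b -> `|phi s| <= C) ->
  (forall s, a <= s <= b -> `|psi s| <= C) ->
  `|vint a b (fun s => phi s + k (t - s) *: psi s)| <= C * abel_modulus (b - a).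
Proof.
move=> /andP[ab bt] cphi cpsi bphi bpsi.
have C0 : 0 <= C by apply: le_trans (bphi a _); rewrite ?normr_ge0// lexx ab.
have iK := integrable_abel_kernel a bt.
have iCK : leb.-integrable `[a, b] (EFin \o (fun s => C * k (t - s))).
  apply: eq_integrable (integrableZl _ C iK) => // s _ /=; by rewrite EFinM.
apply: (@le_trans _ _ (\int[leb]_(s in `[a, b]) (C + C * k (t - s)))).
  apply: norm_vint_le => //; first exact: abel_integrand_vintegrable.
    by apply: eq_integrable (integrableD _ (integrable_cst_itv a b C) iCK).
  move=> s /andP[as_ /ltW sb]; have sab : a <= s <= b by rewrite as_.
  apply: le_trans (ler_normD _ _) _; apply: lerD; first exact: bphi.
  rewrite normrZ ger0_norm ?abel_kernel_ge0// mulrC.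
  by apply: ler_wpM2r; [exact: abel_kernel_ge0|exact: bpsi].
rewrite (RintegralD _ (integrable_cst_itv a b C) iCK)// Rintegral_cst_itv//.
rewrite RintegralZl// Rintegral_abel_kernel ?ab//.
rewrite -mulrDr ler_wpM2l// lerD// ler_pM2l// lerBlDr.
rewrite (_ : t - a = (b - a) + (t - b)); last by ring.
by rewrite sqrtr_subadd// subr_ge0.
Qed.

(** Besides the new piece of integral over [[t, t']], going from [t] to [t']
    changes the kernel on [[a, t[]. The kernel decreases with time there, so the
    L1 norm of this change is the difference of two explicit integrals, and it is
    at most [2 sqrt (t' - t)]. *)
Lemma abel_integral_modulus phi psi a t t' C : a <= t <= t' ->
  {within `[a, t'], continuous phi} -> {within `[a, t'], continuous psi} ->
  (forall s, a <= s <= t' -> `|phi s| <= C) ->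
  (forall s, a <= s <= t' -> `|psi s| <= C) ->
  `|abel_integral phi psi a t' - abel_integral phi psi a t|
    <= C * (2 * abel_modulus (t' - t)).
Proof.
move=> /andP[at_ tt'] cphi cpsi bphi bpsi.
have C0 : 0 <= C.
  by apply: le_trans (bphi a _); rewrite ?normr_ge0// lexx (le_trans at_).
have sub b c f : a <= b -> c <= t' -> {within `[a, t'], continuous f} ->
    {within `[b, c], continuous f}.
  by move=> ab ct; apply: continuous_subspaceW; apply: subset_itv; rewrite bnd_simp.
rewrite /abel_integral (vint_split (c := t)) ?at_//; last exact: abel_integrand_vintegrable.
rewrite addrAC -vintB; last 2 first.
- by apply: abel_integrand_vintegrable => //; exact: sub.
- by apply: abel_integrand_vintegrable => //; exact: sub.
have -> : C * (2 * abel_modulus (t' - t)) =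
   C * abel_modulus (t' - t) + C * abel_modulus (t' - t) by ring.
apply: le_trans (ler_normD _ _) _; apply: lerD; last first.
  apply: norm_abel_integral_le; rewrite ?tt' ?lexx//; try exact: sub.
    by move=> s /andP[ts st]; apply: bphi; rewrite st (le_trans at_).
  by move=> s /andP[ts st]; apply: bpsi; rewrite st (le_trans at_).
have -> : (fun s => phi s + k (t' - s) *: psi s - (phi s + k (t - s) *: psi s)) =
    (fun s => k (t' - s) *: psi s - k (t - s) *: psi s).
  by apply/funext => s; rewrite opprD addrACA subrr add0r.
have i1 := integrable_abel_kernel a (lexx t).
have i2 := integrable_abel_kernel a tt'.
have i3 : leb.-integrable `[a, t] (EFin \o (fun s => k (t - s) - k (t' - s))).
  by apply: eq_integrable (integrableB _ i1 i2) => // s _ /=; rewrite EFinB.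
have i4 : leb.-integrable `[a, t] (EFin \o (fun s => C * (k (t - s) - k (t' - s)))).
  by apply: eq_integrable (integrableZl _ C i3) => // s _ /=; rewrite EFinM.
apply: (@le_trans _ _ (\int[leb]_(s in `[a, t]) (C * (k (t - s) - k (t' - s))))).
  apply: norm_vint_le => //.
    by apply: vintegrableB; apply: abel_vintegrable => //; exact: sub.
  move=> s /andP[as_ st].
  rewrite -scalerBl normrZ mulrC distrC ger0_norm; last first.
    rewrite subr_ge0 lef_pV2 ?posrE ?sqrtr_gt0 ?subr_gt0//; last exact: lt_le_trans tt'.
    by rewrite ler_wsqrtr// lerD2r.
  apply: ler_wpM2r; last by apply: bpsi; rewrite as_ (le_trans (ltW st)).
  rewrite subr_ge0 lef_pV2 ?posrE ?sqrtr_gt0 ?subr_gt0//; last exact: lt_le_trans tt'.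
  by rewrite ler_wsqrtr// lerD2r.
rewrite RintegralZl// RintegralB// !Rintegral_abel_kernel ?at_ ?lexx//.
apply: ler_wpM2l => //; rewrite subrr sqrtr0 subr0 /abel_modulus.
have : Num.sqrt (t - a) <= Num.sqrt (t' - a) by rewrite ler_wsqrtr// lerD2r.
have : 0 <= t' - t by rewrite subr_ge0.
lra.
Qed.

Lemma within_modulus_continuous (A : set K) (V : normedModType K) (v : K -> V)
    (w : K -> K) : {for 0, continuous w} -> w 0 = 0 ->
  (forall s t, A s -> A t -> s <= t -> `|v t - v s| <= w (t - s)) ->
  {within A, continuous v}.
Proof.
move=> cw w0 H; apply/subspace_continuousP => x Ax.
apply/cvgrPdist_lt => e e0.
have /cvgrPdist_lt/(_ _ e0) : w h @[h --> 0] --> (0 : K) by rewrite -{2}w0.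
case/nbhs_ballP => d d0 dw.
rewrite /within /=; apply/nbhs_ballP; exists d => // y /=.
have small z : `|z| < d -> `|w z| < e.
  by move=> zd; have := dw z; rewrite /ball/= !sub0r !normrN; exact.
rewrite /ball/= => xy Ay; case: (leP x y) => [xy'|/ltW yx].
  rewrite distrC; apply: le_lt_trans (H _ _ Ax Ay xy') _.
  by apply: le_lt_trans (ler_norm _) _; apply: small; rewrite distrC.
apply: le_lt_trans (H _ _ Ay Ax yx) _.
by apply: le_lt_trans (ler_norm _) _; apply: small.
Qed.

Lemma abel_integral_continuous phi psi a b C :
  {within `[a, b], continuous phi} -> {within `[a, b], continuous psi} ->
  (forall s, a <= s <= b -> `|phi s| <= C) ->
  (forall s, a <= s <= b -> `|psi s| <= C) ->
  {within `[a, b], continuous (abel_integral phi psi a)}.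
Proof.
move=> cphi cpsi bphi bpsi.
apply: (@within_modulus_continuous _ _ _ (fun d => C * (2 * abel_modulus d))).
- apply: cvgMl_tmp; apply: cvgMl_tmp; apply: cvgD; first exact: cvg_id.
  by apply: cvgMl_tmp; exact: sqrt_continuous.
- by rewrite /abel_modulus sqrtr0 !mulr0 addr0 !mulr0.
move=> s t /=; rewrite !in_itv/= => /andP[as_ sb] /andP[at_ tb] st.
apply: abel_integral_modulus; first by rewrite as_.
- by apply: continuous_subspaceW cphi; apply: subset_itv; rewrite bnd_simp.
- by apply: continuous_subspaceW cpsi; apply: subset_itv; rewrite bnd_simp.
- by move=> r /andP[ar rt]; apply: bphi; rewrite ar (le_trans rt).
- by move=> r /andP[ar rt]; apply: bpsi; rewrite ar (le_trans rt).
Qed.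
End AbelOperator.

(** * Limits of geometrically convergent sequences *)
Lemma geometric_lt (K : realType) (M e : K) : 0 < e -> exists n, M / 2 ^+ n < e.
Proof.
move=> e0; exists (Num.truncn (M / e)).+1.
rewrite ltr_pdivrMr ?exprn_gt0// mulrC -ltr_pdivrMr//.
apply: lt_le_trans (truncnS_gt _) _; rewrite -natrX ler_nat ltnW//.
exact: ltn_expl.
Qed.

Lemma geometric_small (K : realType) (M x : K) :
  (forall n, x <= M / 2 ^+ n) -> x <= 0.
Proof.
move=> H; rewrite leNgt; apply/negP => /(geometric_lt M)[n].
by rewrite ltNge H.
Qed.

Lemma geometric_limit (K : realType) (m p : nat) (x : nat -> 'M[K]_(m, p)) (M : K) :
  (forall n, `|x n.+1 - x n| <= M / 2 ^+ n) ->
  exists l, forall n, `|l - x n| <= 2 * M / 2 ^+ n.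
Proof.
move=> H; have M0 : 0 <= M.
  by have := le_trans (normr_ge0 _) (H 0); rewrite expr0 divr1.
have p0 n : 0 < 2 ^+ n :> K by rewrite exprn_gt0.
have far n j : `|x (n + j)%N - x n| <= 2 * M / 2 ^+ n - 2 * M / 2 ^+ (n + j).
  elim: j => [|j IH]; first by rewrite addn0 !subrr normr0.
  rewrite addnS (_ : x (n + j).+1 - x n =
    (x (n + j).+1 - x (n + j)%N) + (x (n + j)%N - x n)); last by rewrite addrA subrK.
  apply: le_trans (ler_normD _ _) _; apply: le_trans (lerD (H _) IH) _.
  rewrite [2 ^+ (n + j).+1]exprSr invfM.
  by have := p0 (n + j)%N; have := p0 n; lra.
have far' n j : (n <= j)%N -> `|x j - x n| <= 2 * M / 2 ^+ n.
  move=> nj; rewrite -(subnKC nj); apply: le_trans (far _ _) _.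
  by rewrite lerBlDr lerDl divr_ge0 ?mulr_ge0// ltW.
have cx : cvg (x @ \oo).
  apply: cauchy_cvg; apply: cauchy_exP => e e0.
  have [n ne] := geometric_lt (2 * M) e0.
  exists (x n); exists n => // j /= nj.
  by rewrite -ball_normE/= distrC; apply: le_lt_trans ne; exact: far'.
exists (lim (x @ \oo)) => n.
apply/ler_addgt0Pr => e e0.
have /cvgrPdist_lt/(_ _ e0)[N _ HN] := cx.
have := HN (maxn N n) (leq_maxl _ _) => /ltW h1.
rewrite (_ : _ - x n = (lim (x @ \oo) - x (maxn N n)) + (x (maxn N n) - x n)); last first.
  by rewrite addrA subrK.
apply: le_trans (ler_normD _ _) _; rewrite addrC; apply: lerD => //.
exact/far'/leq_maxr.
Qed.

Lemma within_uniform_limit_continuous (K : realType) (V : normedModType K) (A : set K)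
    (x : nat -> K -> V) (l : K -> V) (M : K) :
  (forall n, {within A, continuous (x n)}) ->
  (forall n t, A t -> `|l t - x n t| <= M / 2 ^+ n) ->
  {within A, continuous l}.
Proof.
move=> cx H; apply/subspace_continuousP => t At.
apply/cvgrPdist_lt => e e0.
have e3 : 0 < e / 3 by rewrite divr_gt0.
have [n ne] := geometric_lt M e3.
have /subspace_continuousP/(_ _ At)/cvgrPdist_lt/(_ _ e3) := cx n.
rewrite !near_withinE; apply: filterS => s Hs As.
rewrite (_ : l t - l s = (l t - x n t) + (x n t - x n s) + (x n s - l s)); last first.
  by rewrite !addrA !subrK.
have h1 := le_lt_trans (H n t At) ne.
have h2 := le_lt_trans (H n s As) ne.
have h3 := Hs As.
apply: le_lt_trans (ler_normD _ _) _; rewrite [`|x n s - _|]distrC.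
have := ler_normD (l t - x n t) (x n t - x n s).
lra.
Qed.

(** * Volterra equations with a weakly singular kernel *)
Section Volterra.
Context (K : realType) (m : nat).
Local Notation E := 'cV[K]_m.
Context (t0 : K) (Omega : set E) (x0 : E) (r : K).

(** The Lipschitz condition is asymmetric: [x] ranges over the ball where the
    solution is built, [x'] over all of [Omega]. Uniqueness then holds among all
    solutions with values in [Omega], including those that leave the ball, on
    the very interval of existence. A term such as [M(y) w], which is not globally
    Lipschitz since [w] is unbounded, still satisfies it. *)
Definition admissible_field (C L : K) (h : E -> K -> E) : Prop :=
  [/\ {within Omega `*` [set s | t0 <= s], continuous (fun z => h z.1 z.2)},
      (forall x s, `|x - x0| <= r -> t0 <= s -> `|h x s| <= C)
    & (forall x x' s, `|x - x0| <= r -> Omega x' -> t0 <= s ->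
         `|h x s - h x' s| <= L * `|x - x'|)].

Context (f g : E -> K -> E).

Definition volterra_map (X : K -> E) (t : K) : E :=
  x0 + abel_integral (fun s => f (X s) s) (fun s => g (X s) s) t0 t.

Definition volterra_solution (d : K) (X : K -> E) : Prop :=
  [/\ {within `[t0, t0 + d], continuous X},
      (forall t, t0 <= t <= t0 + d -> Omega (X t))
    & (forall t, t0 <= t <= t0 + d -> X t = volterra_map X t)].

Lemma field_along_continuous C L h (X : K -> E) (d : K) : admissible_field C L h ->
  {within `[t0, t0 + d], continuous X} ->
  (forall t, t0 <= t <= t0 + d -> Omega (X t)) ->
  {within `[t0, t0 + d], continuous (fun s => h (X s) s)}.
Proof.
move=> [/subspace_continuousP ch _ _] /subspace_continuousP cX OX.
apply/subspace_continuousP => s sI; have := sI; rewrite /= in_itv/= => sab.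
have zs : (Omega `*` [set s | t0 <= s]) (X s, s).
  by split; [exact: OX|case/andP: sab].
apply: (@cvg_comp _ _ _ (fun s => (X s, s)) (fun z => h z.1 z.2) _
  (within (Omega `*` [set s | t0 <= s]) (nbhs (X s, s)))); last exact: (ch _ zs).
have c2 : (X u, u) @[u --> within `[t0, t0 + d] (nbhs s)] --> (X s, s).
  exact: (cvg_pair (cX _ sI) (@cvg_within _ _ _ _)).
move=> P PX; have := c2 _ PX; rewrite !near_simpl !near_withinE.
apply: filterS => u Pu uI; apply: (Pu uI); split => /=.
  by apply: OX; move: uI; rewrite /= in_itv.
by move: uI; rewrite /= in_itv/= => /andP[].
Qed.

Hypothesis r_gt0 : 0 < r.
Hypothesis ballO : forall x, `|x - x0| <= r -> Omega x.
Context (C L : K).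
Hypothesis L0 : 0 <= L.
Hypothesis af : admissible_field C L f.
Hypothesis ag : admissible_field C L g.

Section ShortTime.
Context (d : K).
Hypothesis dC : C * abel_modulus d <= r.
Hypothesis dL : L * abel_modulus d <= 2^-1.

Local Notation I := (`[t0, t0 + d]%classic).
Local Notation continuousI X := {within I, continuous X}.

Definition in_ball (X : K -> E) :=
  continuousI X /\ forall t, t0 <= t <= t0 + d -> `|X t - x0| <= r.

Lemma bound_ge0 : 0 <= C.
Proof.
have [_ H _] := af; apply: le_trans (H x0 t0 _ (lexx _)); first exact: normr_ge0.
by rewrite subrr normr0 ltW.
Qed.

Lemma volterra_map_in_ball X : in_ball X -> in_ball (volterra_map X).
Proof.
move=> [cX bX]; have OX t : t0 <= t <= t0 + d -> Omega (X t) by move=> /bX/ballO.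
have cf := field_along_continuous af cX OX.
have cg := field_along_continuous ag cX OX.
have bf s : t0 <= s <= t0 + d -> `|f (X s) s| <= C.
  by have [_ H _] := af; move=> sI; apply: H; [exact: bX|case/andP: sI].
have bg s : t0 <= s <= t0 + d -> `|g (X s) s| <= C.
  by have [_ H _] := ag; move=> sI; apply: H; [exact: bX|case/andP: sI].
split.
  move=> s; apply: continuousD; first exact: cst_continuous.
  exact: (abel_integral_continuous cf cg bf bg).
move=> t /andP[t0t td]; rewrite /volterra_map addrC addKr.
have W s : t0 <= s <= t -> t0 <= s <= t0 + d.
  by move=> /andP[-> st]; rewrite (le_trans st).
apply: le_trans dC; apply: le_trans (norm_abel_integral_le (C := C) _ _ _ _ _) _.
- by rewrite t0t lexx.
- by apply: continuous_subspaceW cf; apply: subset_itv; rewrite bnd_simp.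
- by apply: continuous_subspaceW cg; apply: subset_itv; rewrite bnd_simp.
- by move=> s /W; exact: bf.
- by move=> s /W; exact: bg.
apply: ler_wpM2l; [exact: bound_ge0|apply: abel_modulus_le].
by rewrite lerBlDl.
Qed.

(** Only [X] has to stay in the ball, which is what the asymmetric Lipschitz
    condition permits. *)
Lemma volterra_map_contraction X X' e : in_ball X -> continuousI X' ->
  (forall t, t0 <= t <= t0 + d -> Omega (X' t)) ->
  (forall t, t0 <= t <= t0 + d -> `|X t - X' t| <= e) ->
  forall t, t0 <= t <= t0 + d -> `|volterra_map X t - volterra_map X' t| <= e / 2.
Proof.
move=> [cX bX] cX' OX' Xe t /andP[t0t td].
have e0 : 0 <= e by apply: le_trans (Xe t _); rewrite ?normr_ge0// t0t.
have OX s : t0 <= s <= t0 + d -> Omega (X s) by move=> /bX/ballO.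
have sub (h : K -> E) : continuousI h -> {within `[t0, t], continuous h}.
  by apply: continuous_subspaceW; apply: subset_itv; rewrite bnd_simp.
have cf := sub _ (field_along_continuous af cX OX).
have cg := sub _ (field_along_continuous ag cX OX).
have cf' := sub _ (field_along_continuous af cX' OX').
have cg' := sub _ (field_along_continuous ag cX' OX').
rewrite /volterra_map opprD addrACA subrr add0r /abel_integral -vintB; last 2 first.
- exact: (abel_integrand_vintegrable (lexx t) cf cg).
- exact: (abel_integrand_vintegrable (lexx t) cf' cg').
under eq_vint do rewrite opprD addrACA -scalerBr.
have W s : t0 <= s <= t -> t0 <= s <= t0 + d.
  by move=> /andP[-> st]; rewrite (le_trans st).
have bh h : admissible_field C L h -> forall s, t0 <= s <= t ->
    `|h (X s) s - h (X' s) s| <= L * e.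
  move=> [_ _ H] s /W sI; apply: le_trans (H _ _ _ (bX _ sI) (OX' _ sI) _) _.
    by case/andP: sI.
  by apply: ler_wpM2l => //; exact: Xe.
apply: le_trans (norm_abel_integral_le (C := L * e) _ _ _ _ _) _.
- by rewrite t0t lexx.
- by move=> s; apply: continuousB; [exact: cf|exact: cf'].
- by move=> s; apply: continuousB; [exact: cg|exact: cg'].
- exact: bh af.
- exact: bh ag.
rewrite mulrAC mulrC; apply: ler_wpM2l => //; apply: le_trans dL.
by apply: ler_wpM2l => //; apply: abel_modulus_le; rewrite lerBlDl.
Qed.

(** Two solutions differ by some finite [M] on the compact interval, and both
    are fixed points of the map; hence they differ by [M / 2^n] for all [n]. *)
Lemma volterra_short_unique X X' : volterra_solution d X -> in_ball X ->
  volterra_solution d X' -> forall t, t0 <= t <= t0 + d -> X' t = X t.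
Proof.
move=> [cX OX eX] bX [cX' OX' eX'].
have [M HM] : exists M, forall t, t0 <= t <= t0 + d -> `|X t - X' t| <= M.
  have cD : continuousI (fun t => X t - X' t).
    by move=> s; apply: continuousB; [exact: cX|exact: cX'].
  have /compact_bounded[M [_ H]] := continuous_compact cD (@segment_compact K t0 (t0 + d)).
  exists (M + 1) => t tI; apply: (H (M + 1)); first by rewrite ltrDl.
  by exists t => //; rewrite /= in_itv.
have HMn n t : t0 <= t <= t0 + d -> `|X t - X' t| <= M / 2 ^+ n.
  elim: n t => [|n IH] t tI; first by rewrite expr0 divr1; exact: HM.
  rewrite eX// eX'// exprSr invfM mulrA.
  exact: volterra_map_contraction.
move=> t tI; apply/eqP; rewrite eq_sym -subr_eq0 -normr_le0; apply/eqP/eqP.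
by apply: (@geometric_small _ M) => n; exact: HMn.
Qed.

Fixpoint picard n : K -> E :=
  if n is n'.+1 then volterra_map (picard n') else cst x0.

Lemma picard_in_ball n : in_ball (picard n).
Proof.
elim: n => [|n IH]; last exact: volterra_map_in_ball.
split; first by apply: continuous_subspaceT => s; exact: cst_continuous.
by move=> t _; rewrite /= subrr normr0 ltW.
Qed.

Lemma picard_step n t : t0 <= t <= t0 + d ->
  `|picard n.+1 t - picard n t| <= r / 2 ^+ n.
Proof.
elim: n t => [|n IH] t tI.
  by rewrite expr0 divr1; have [_] := picard_in_ball 1; exact.
rewrite exprSr invfM mulrA.
apply: (volterra_map_contraction (picard_in_ball n.+1)) => //.
  by have [] := picard_in_ball n.
by move=> s sI; apply: ballO; have [_] := picard_in_ball n; exact.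
Qed.

(** The Picard iterates converge geometrically, uniformly on the interval; the
    limit inherits continuity and the ball, and the contraction estimate makes it
    a fixed point. *)
Lemma volterra_short_exists : exists X, volterra_solution d X /\ in_ball X.
Proof.
have [X HX] : exists X : K -> E, forall t, t0 <= t <= t0 + d ->
    forall n, `|X t - picard n t| <= 2 * r / 2 ^+ n.
  suff /choice[X HX] : forall t, exists l : E, t0 <= t <= t0 + d ->
     forall n, `|l - picard n t| <= 2 * r / 2 ^+ n by exists X.
  move=> t.
  have [tI|_] := boolP (t0 <= t <= t0 + d); last by exists x0.
  have [l Hl] := @geometric_limit _ _ _ (fun n => picard n t) r (fun n => picard_step n tI).
  by exists l.
have cX : continuousI X.
  apply: (@within_uniform_limit_continuous _ _ _ picard X (2 * r)).
    by move=> n; have [] := picard_in_ball n.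
  by move=> n t; rewrite /= in_itv/= => /HX.
have bX t : t0 <= t <= t0 + d -> `|X t - x0| <= r.
  move=> tI; rewrite -subr_le0; apply: (@geometric_small _ (2 * r)) => n.
  rewrite lerBlDr (_ : X t - x0 = (X t - picard n t) + (picard n t - x0)); last first.
    by rewrite addrA subrK.
  apply: le_trans (ler_normD _ _) _; apply: lerD; first exact: HX.
  by have [_] := picard_in_ball n; exact.
have OX t : t0 <= t <= t0 + d -> Omega (X t) by move=> /bX/ballO.
exists X; split=> //; split => // t tI.
apply/eqP; rewrite -subr_eq0 -normr_le0; apply: (@geometric_small _ (2 * r)) => n.
have h1 := HX t tI n.+1.
have h2 := @volterra_map_contraction (picard n) X _ (picard_in_ball n) cX OX
   (fun s sI => (eq_ind_r (fun x => x <= _) (HX s sI n) (distrC _ _))) t tI.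
rewrite (_ : X t - _ = (X t - picard n.+1 t) + (picard n.+1 t - volterra_map X t)); last first.
  by rewrite addrA subrK.
apply: le_trans (ler_normD _ _) _; apply: le_trans (lerD h1 h2) _.
by rewrite exprSr invfM mulrA -splitr.
Qed.
End ShortTime.

(** With [d = e^2] and [e <= 1] one has [d + 2 sqrt d <= 3 e], so that the
    smallness conditions of a short interval are linear in [e]. *)
Theorem volterra_wellposed : exists2 d, 0 < d & exists2 X,
  volterra_solution d X &
  forall X', volterra_solution d X' -> forall t, t0 <= t <= t0 + d -> X' t = X t.
Proof.
(* This choice gives [e <= 1], [3 C e <= r] and [6 L e <= 1] at once. *)
pose e := (1 + 3 * C / r + 6 * L)^-1.
have C0 := bound_ge0.
have D0 : 0 <= 3 * C / r by rewrite divr_ge0 ?mulr_ge0// ltW.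
have L60 : 0 <= 6 * L by rewrite mulr_ge0.
have e'0 : 0 < 1 + 3 * C / r + 6 * L by rewrite ltr_wpDr// ltr_wpDr.
have e0 : 0 < e by rewrite invr_gt0.
have E1 : e * (1 + 3 * C / r + 6 * L) = 1 by rewrite mulVf// gt_eqF.
have e1 : e <= 1 by rewrite invf_le1// -addrA lerDl addr_ge0.
have me : abel_modulus (e ^+ 2) <= 3 * e.
  rewrite /abel_modulus sqrtr_sqr gtr0_norm// expr2.
  have : e * e <= e by rewrite ger_pMl.
  lra.
have d0 : 0 < e ^+ 2 by rewrite exprn_gt0.
have dC : C * abel_modulus (e ^+ 2) <= r.
  apply: le_trans (ler_wpM2l C0 me) _.
  have : e * (3 * C / r) <= 1 by rewrite -[leRHS]E1 ler_wpM2l ?(ltW e0)//; lra.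
  rewrite mulrA ler_pdivrMr// mul1r; lra.
have dL : L * abel_modulus (e ^+ 2) <= 2^-1.
  apply: le_trans (ler_wpM2l L0 me) _.
  have : e * (6 * L) <= 1 by rewrite -[leRHS]E1 ler_wpM2l ?(ltW e0)//; lra.
  lra.
have [X [sX bX]] := volterra_short_exists dC dL.
exists (e ^+ 2) => //; exists X => // X' sX'.
exact: (volterra_short_unique dL sX bX sX').
Qed.

End Volterra.

(** * Bounded Lipschitz fields *)
Section BoundedLipschitz.
Context (K : realType) (T : normedModType K) (S : set T).

(** The two conditions go together because a product of Lipschitz functions is
    Lipschitz when its factors are bounded. *)
Definition bounded_lipschitz (V : normedModType K) (F : T -> V) : Prop :=
  exists C, [/\ 0 <= C, forall z, S z -> `|F z| <= C
    & forall z z', S z -> S z' -> `|F z - F z'| <= C * `|z - z'|].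

Lemma bounded_lipschitzP (V : normedModType K) (F : T -> V) :
  [bounded F z | z in S] -> [lipschitz F z | z in S] -> bounded_lipschitz F.
Proof.
move=> /pinfty_ex_gt0[M M0 HM] /pinfty_ex_gt0[L L0 HL].
exists (M + L); split; first by rewrite addr_ge0// ltW.
  by move=> z Sz; apply: le_trans (HM z Sz) _; rewrite lerDl ltW.
move=> z z' Sz Sz'; apply: le_trans (HL (z, z') _) _ => //=.
by rewrite ler_wpM2r// lerDr ltW.
Qed.

Section Algebra.
Context (V : normedModType K).
Implicit Types F G : T -> V.

Lemma eq_bounded_lipschitz F G : (forall z, S z -> F z = G z) ->
  bounded_lipschitz F -> bounded_lipschitz G.
Proof.
move=> FG [C [C0 b l]]; exists C; split=> //.
  by move=> z Sz; rewrite -FG//; exact: b.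
by move=> z z' Sz Sz'; rewrite -!FG//; exact: l.
Qed.

Lemma bounded_lipschitz_cst v : bounded_lipschitz (fun=> v : V).
Proof.
by exists `|v|; split => // z z' _ _; rewrite subrr normr0 mulr_ge0.
Qed.

Lemma bounded_lipschitzD F G : bounded_lipschitz F -> bounded_lipschitz G ->
  bounded_lipschitz (fun z => F z + G z).
Proof.
move=> [C [C0 b l]] [C' [C0' b' l']]; exists (C + C'); split.
- exact: addr_ge0.
- move=> z Sz; apply: le_trans (ler_normD _ _) _.
  by apply: lerD; [exact: b|exact: b'].
move=> z z' Sz Sz'; rewrite opprD addrACA mulrDl.
by apply: le_trans (ler_normD _ _) _; apply: lerD; [exact: l|exact: l'].
Qed.

Lemma bounded_lipschitzZ c F : bounded_lipschitz F ->
  bounded_lipschitz (fun z => c *: F z).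
Proof.
move=> [C [C0 b l]]; exists (`|c| * C); split; first exact: mulr_ge0.
- by move=> z Sz; rewrite normrZ ler_wpM2l//; exact: b.
- by move=> z z' Sz Sz'; rewrite -scalerBr normrZ -mulrA ler_wpM2l//; exact: l.
Qed.

Lemma bounded_lipschitzB F G : bounded_lipschitz F -> bounded_lipschitz G ->
  bounded_lipschitz (fun z => F z - G z).
Proof.
move=> bF bG; apply: bounded_lipschitzD => //.
by apply: eq_bounded_lipschitz (bounded_lipschitzZ (-1) bG) => z _; rewrite scaleN1r.
Qed.

Lemma bounded_lipschitz_sum (I : Type) (r : seq I) (F : I -> T -> V) :
  (forall i, bounded_lipschitz (F i)) ->
  bounded_lipschitz (fun z => \sum_(i <- r) F i z).
Proof.
move=> bF; elim: r => [|i r IH].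
  by apply: eq_bounded_lipschitz (bounded_lipschitz_cst 0) => z _; rewrite big_nil.
by apply: eq_bounded_lipschitz (bounded_lipschitzD (bF i) IH) => z _; rewrite big_cons.
Qed.
End Algebra.

Lemma bounded_lipschitz_mx m n (F : T -> 'M[K]_(m, n)) :
  (forall i j, bounded_lipschitz (fun z => F z i j : K^o)) -> bounded_lipschitz F.
Proof.
move=> H.
have /choice[c Hc] ij : exists C, [/\ 0 <= C, forall z, S z -> `|F z ij.1 ij.2| <= C
    & forall z z', S z -> S z' -> `|F z ij.1 ij.2 - F z' ij.1 ij.2| <= C * `|z - z'|].
  exact: H.
have cC i j : c (i, j) <= \sum_ij c ij.
  by rewrite (bigD1 (i, j))//= lerDl sumr_ge0// => ij _; have [] := Hc ij.
have C0 : 0 <= \sum_ij c ij by rewrite sumr_ge0// => ij _; have [] := Hc ij.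
exists (\sum_ij c ij); split => //.
  move=> z Sz; apply/mx_norm_leP => // i j; apply: le_trans (cC i j).
  by have [_ b _] := Hc (i, j); exact: b.
move=> z z' Sz Sz'; apply/mx_norm_leP => [|i j]; first exact: mulr_ge0.
rewrite !mxE; apply: (@le_trans _ _ (c (i, j) * `|z - z'|)).
  by have [_ _ l] := Hc (i, j); exact: l.
by rewrite ler_wpM2r.
Qed.

Lemma bounded_lipschitz_coord m n (F : T -> 'M[K]_(m, n)) i j :
  bounded_lipschitz F -> bounded_lipschitz (fun z => F z i j : K^o).
Proof.
move=> [C [C0 b l]]; exists C; split => //.
  by move=> z Sz; apply: le_trans (b _ Sz); exact: mx_coord_le.
move=> z z' Sz Sz'; apply: le_trans (l _ _ Sz Sz').
by have := mx_coord_le (F z - F z') i j; rewrite !mxE.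
Qed.

Lemma bounded_lipschitzM (F G : T -> K^o) : bounded_lipschitz F -> bounded_lipschitz G ->
  bounded_lipschitz (fun z => F z * G z : K^o).
Proof.
move=> [C [C0 b l]] [C' [C0' b' l']]; exists (C * C' + (C * C' + C * C')); split.
- by rewrite !addr_ge0// mulr_ge0.
- move=> z Sz; rewrite normrM; apply: (@le_trans _ _ (C * C')).
    by apply: ler_pM => //; [exact: b|exact: b'].
  by rewrite lerDl addr_ge0// mulr_ge0.
move=> z z' Sz Sz'.
rewrite (_ : F z * G z - F z' * G z' = F z * (G z - G z') + (F z - F z') * G z'); last first.
  by rewrite mulrBr mulrBl addrA subrK.
rewrite [leRHS]mulrDl; apply: (@le_trans _ _ ((C * C' + C * C') * `|z - z'|)); last first.
  by rewrite lerDr; do !apply: mulr_ge0.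
apply: le_trans (ler_normD _ _) _; rewrite !normrM [leRHS]mulrDl; apply: lerD.
  by rewrite -mulrA; apply: ler_pM => //; [exact: b|exact: l'].
by rewrite mulrAC; apply: ler_pM => //; [exact: l|exact: b'].
Qed.

Lemma bounded_lipschitz_mulmx m n p (F : T -> 'M[K]_(m, n)) (G : T -> 'M[K]_(n, p)) :
  bounded_lipschitz F -> bounded_lipschitz G ->
  bounded_lipschitz (fun z => F z *m G z).
Proof.
move=> bF bG; apply: bounded_lipschitz_mx => i j.
apply: (@eq_bounded_lipschitz _ (fun z => \sum_k F z i k * G z k j)).
  by move=> z _; rewrite mxE.
by apply: bounded_lipschitz_sum => k; apply: bounded_lipschitzM;
  exact: bounded_lipschitz_coord.
Qed.
End BoundedLipschitz.

(** * Regularity of the coefficients *)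
Section Coefficients.
Context (K : realType) (n : nat).
Local Notation E := 'cV[K]_n.

Lemma time_increments_proper (t : K) : 0 <= t -> ProperFilter (time_increments t).
Proof.
move=> t0; apply: Build_ProperFilter_ex => P.
rewrite /time_increments => /= /nbhs_ballP[e e0 H].
exists (e / 2); apply: H => /=.
- by rewrite /ball/= sub0r normrN gtr0_norm ?divr_gt0// ltr_pdivrMr// ltr_pMr// ltr1n.
- by rewrite gt_eqF// divr_gt0.
- by rewrite addr_ge0// divr_ge0// ltW.
Qed.

(** A derivative of [laplacian u] is the derivative of a sum of total functions,
    so it splits only at points where each summand is differentiable. This is
    what identifies the derivatives of the Laplacian with third order
    derivatives of [u]. *)
Lemma partial_sum (i : option 'I_n) (h : 'I_n -> E * K -> E) z :
  0 <= z.2 -> (forall j, has_partial i (h j) z) ->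
  partial i (fun z => \sum_j h j z) z = \sum_j partial i (h j) z.
Proof.
move=> z0; case: i => [k|] /= H.
  have -> : (fun z => \sum_j h j z) = \sum_j h j.
    by apply/funext => x; rewrite fct_sumE.
  exact: derive_sum.
have PF := time_increments_proper z0.
apply: cvg_lim; first exact: norm_hausdorff.
have -> : time_quotient (fun z => \sum_j h j z) z =
    (fun x => \sum_j time_quotient (h j) z x).
  by apply/funext => x; rewrite /time_quotient -sumrB scaler_sumr.
apply: cvg_big => [|j _]; first exact: add_continuous.
exact: H.
Qed.

Context (D : set E) (u : E * K -> E).
Hypothesis hu : regular_velocity D u.
Local Notation blip := (@bounded_lipschitz K _ (spacetime D) _).

Lemma bounded_lipschitz_partials s : (size s <= 3)%N -> blip (partials s u).
Proof. by move=> s3; have [_ /(_ s s3)[b l]] := hu; exact: bounded_lipschitzP. Qed.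

Lemma bounded_lipschitz_velocity : blip u.
Proof. exact: (@bounded_lipschitz_partials [::]). Qed.

Lemma bounded_lipschitz_laplacian : blip (laplacian u).
Proof.
by apply: bounded_lipschitz_sum => j; exact: (@bounded_lipschitz_partials [:: Some j; Some j]).
Qed.

Lemma bounded_lipschitz_partial_laplacian i : blip (partial i (laplacian u)).
Proof.
apply: (@eq_bounded_lipschitz _ _ _ _
  (fun z => \sum_j partials [:: i; Some j; Some j] u z)).
  move=> z Sz; apply/esym/partial_sum; first by case: Sz.
  by move=> j; have [[H _] _] := hu; exact: (H [:: Some j; Some j]).
by apply: bounded_lipschitz_sum => j; exact: bounded_lipschitz_partials.
Qed.

Lemma bounded_lipschitz_jacobian f : (forall j, blip (partial (Some j) f)) -> blip (jacobian f).
Proof.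
move=> bf; apply: bounded_lipschitz_mx => i j.
apply: eq_bounded_lipschitz (bounded_lipschitz_coord i 0 (bf j)).
by move=> z _; rewrite mxE.
Qed.

Lemma bounded_lipschitz_material f : (forall i, blip (partial i f)) -> blip (material u f).
Proof.
move=> bf; apply: bounded_lipschitzD => //.
by apply: bounded_lipschitz_mulmx; 
  [exact: bounded_lipschitz_jacobian|exact: bounded_lipschitz_velocity].
Qed.

Lemma bounded_lipschitz_partial_velocity i : blip (partial i u).
Proof. exact: (@bounded_lipschitz_partials [:: i]). Qed.

Context (p : mr_params K n).

Lemma bounded_lipschitz_A_u : blip (A_u p u).
Proof.
apply: bounded_lipschitzD; first exact: bounded_lipschitz_velocity.
by apply: bounded_lipschitzZ; exact: bounded_lipschitz_laplacian.
Qed.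

Lemma bounded_lipschitz_M_u : blip (M_u p u).
Proof.
apply: bounded_lipschitzD.
  by apply: bounded_lipschitz_jacobian => j; exact: bounded_lipschitz_partial_velocity.
by apply: bounded_lipschitzZ; apply: bounded_lipschitz_jacobian => j;
  exact: bounded_lipschitz_partial_laplacian.
Qed.

Lemma bounded_lipschitz_B_u : blip (B_u p u).
Proof.
apply: bounded_lipschitzB; first apply: bounded_lipschitzD.
- apply: bounded_lipschitzZ; apply: bounded_lipschitzB; last exact: bounded_lipschitz_cst.
  by apply: bounded_lipschitz_material => i; exact: bounded_lipschitz_partial_velocity.
- by apply: bounded_lipschitzZ; apply: bounded_lipschitz_material => i;
  exact: bounded_lipschitz_partial_laplacian.
apply: bounded_lipschitzZ; apply: bounded_lipschitz_mulmx; last exact: bounded_lipschitz_laplacian.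
exact: bounded_lipschitz_M_u.
Qed.
End Coefficients.

(** * Stacked vectors and locally Lipschitz fields *)
Section Norms.
Context (K : realType).

Lemma norm_mulmx_le m n p (A : 'M[K]_(m, n)) (B : 'M[K]_(n, p)) :
  `|A *m B| <= n%:R * `|A| * `|B|.
Proof.
apply/mx_norm_leP => [|i j]; first by rewrite !mulr_ge0.
rewrite mxE; apply: le_trans (ler_norm_sum _ _ _) _.
have -> : n%:R * `|A| * `|B| = \sum_(k < n) `|A| * `|B|.
  by rewrite sumr_const card_ord -mulrA mulr_natl.
apply: ler_sum => k _.
by rewrite normrM; apply: ler_pM => //; exact: mx_coord_le.
Qed.

(** [A B - A' B' = A' (B - B') + (A - A') B]: among the right factors only [B], not
    [B'], has to be bounded. *)
Lemma norm_mulmxB_le m n p (A A' : 'M[K]_(m, n)) (B B' : 'M[K]_(n, p)) :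
  `|A *m B - A' *m B'| <= n%:R * `|A'| * `|B - B'| + n%:R * `|A - A'| * `|B|.
Proof.
have -> : A *m B - A' *m B' = A' *m (B - B') + (A - A') *m B.
  by rewrite mulmxBr mulmxBl [RHS]addrC addrA subrK.
by apply: le_trans (ler_normD _ _) _; apply: lerD; exact: norm_mulmx_le.
Qed.

Lemma norm_col_mx_leP m n (a : 'cV[K]_m) (b : 'cV[K]_n) (c : K) :
  `|col_mx a b| <= c <-> `|a| <= c /\ `|b| <= c.
Proof.
split=> [H|[ac bc]].
  have c0 : 0 <= c by exact: le_trans H.
  have H' := (mx_norm_leP _ c0).1 H.
  split; apply/mx_norm_leP => // i j.
    by have := H' (lshift n i) j; rewrite col_mxEu.
  by have := H' (rshift m i) j; rewrite col_mxEd.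
have c0 : 0 <= c by exact: le_trans ac.
apply/mx_norm_leP => // i j; rewrite mxE; case: (fintype.split i) => k.
  by apply: le_trans ac; exact: mx_coord_le.
by apply: le_trans bc; exact: mx_coord_le.
Qed.

Lemma norm_usubmx_le m n (x : 'cV[K]_(m + n)) : `|usubmx x| <= `|x|.
Proof. by have := lexx `|x|; rewrite -{1}[x]vsubmxK => /norm_col_mx_leP[]. Qed.

Lemma norm_dsubmx_le m n (x : 'cV[K]_(m + n)) : `|dsubmx x| <= `|x|.
Proof. by have := lexx `|x|; rewrite -{1}[x]vsubmxK => /norm_col_mx_leP[]. Qed.

Lemma vint_col_mx m n a b (f : K -> 'cV[K]_m) (g : K -> 'cV[K]_n) :
  vint a b (fun s => col_mx (f s) (g s)) = col_mx (vint a b f) (vint a b g).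
Proof.
apply/matrixP => i j; rewrite !mxE; case: (fintype.splitP i) => k ik.
  rewrite mxE; have -> : i = lshift n k by exact: val_inj.
  by apply: eq_Rintegral => s _; rewrite col_mxEu.
rewrite mxE; have -> : i = rshift m k by exact: val_inj.
by apply: eq_Rintegral => s _; rewrite col_mxEd.
Qed.

Lemma vintxx n a (f : K -> 'cV[K]_n) : vint a a f = 0.
Proof. by apply/matrixP => i j; rewrite !mxE set_itv1 Rintegral_set1. Qed.

Lemma contractive_continuous (V W : normedModType K) (h : V -> W) :
  (forall x y, `|h x - h y| <= `|x - y|) -> continuous h.
Proof.
move=> H x; apply/cvgrPdist_lt => e e0.
apply/nbhs_ballP; exists e => //= y; rewrite -ball_normE/=.
exact/le_lt_trans/H.
Qed.

Lemma within_continuous_col_mx m n (A : set K) (f : K -> 'cV[K]_m) (g : K -> 'cV[K]_n) :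
  {within A, continuous f} -> {within A, continuous g} ->
  {within A, continuous (fun s => col_mx (f s) (g s))}.
Proof.
move=> /subspace_continuousP cf /subspace_continuousP cg.
apply/subspace_continuousP => s As; apply/cvgrPdist_le => e e0.
have /cvgrPdist_le/(_ _ e0) := cf _ As; have /cvgrPdist_le/(_ _ e0) := cg _ As.
apply: filterS2 => t h1 h2; rewrite opp_col_mx add_col_mx.
by apply/norm_col_mx_leP.
Qed.

Lemma bounded_lipschitz_col_mx (T : normedModType K) (S : set T) m n
    (F : T -> 'cV[K]_m) (G : T -> 'cV[K]_n) :
  bounded_lipschitz S F -> bounded_lipschitz S G ->
  bounded_lipschitz S (fun z => col_mx (F z) (G z)).
Proof.
move=> [C [C0 b l]] [C' [C0' b' l']]; exists (C + C'); split; first exact: addr_ge0.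
  move=> z Sz; apply/norm_col_mx_leP; split.
    by apply: le_trans (b _ Sz) _; rewrite lerDl.
  by apply: le_trans (b' _ Sz) _; rewrite lerDr.
move=> z z' Sz Sz'; rewrite opp_col_mx add_col_mx mulrDl.
apply/norm_col_mx_leP; split.
  by apply: le_trans (l _ _ Sz Sz') _; rewrite lerDl mulr_ge0.
by apply: le_trans (l' _ _ Sz Sz') _; rewrite lerDr mulr_ge0.
Qed.

Lemma bounded_lipschitz_comp (T T' V : normedModType K) (S : set T) (S' : set T')
    (h : T' -> T) (F : T -> V) :
  (forall z, S' z -> S (h z)) -> (forall z z', `|h z - h z'| <= `|z - z'|) ->
  bounded_lipschitz S F -> bounded_lipschitz S' (F \o h).
Proof.
move=> hS hl [C [C0 b l]]; exists C; split => //.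
  by move=> z /hS; exact: b.
move=> z z' /hS Sz /hS Sz'; apply: le_trans (l _ _ Sz Sz') _.
exact: ler_wpM2l.
Qed.

(** Unbounded fields such as [M(y) w] are bounded and Lipschitz on bounded sets
    of states only, which suffices for continuity. *)
Lemma locally_lipschitz_continuous (T1 T2 V : normedModType K) (S : set (T1 * T2))
    (F : T1 * T2 -> V) :
  (forall R, bounded_lipschitz (S `&` [set z | `|z.1| <= R]) F) ->
  {within S, continuous F}.
Proof.
move=> H; apply/subspace_continuousP => z Sz; apply/cvgrPdist_lt => e e0.
have [C [C0 _ l]] := H (`|z.1| + 1).
have C1 : 0 < C + 1 by rewrite ltr_wpDl.
rewrite near_withinE; apply/nbhs_ballP; exists (Num.min 1 (e / (C + 1))) => /=.
  by rewrite lt_min ltr01 divr_gt0.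
move=> z'; rewrite -ball_normE/= lt_min => /andP[z1 ze] Sz'.
apply: le_lt_trans (l _ _ _ _) _.
- by split => //=; rewrite lerDl.
- split => //=; rewrite -[z'.1](subrK z.1) addrC.
  apply: le_trans (ler_normD _ _) _; rewrite lerD2l distrC.
  by apply: le_trans (ltW z1); rewrite [leRHS]prod_normE le_max lexx.
apply: (@le_lt_trans _ _ ((C + 1) * `|z - z'|)).
  by rewrite ler_wpM2r// lerDl.
by rewrite mulrC -ltr_pdivlMr.
Qed.
End Norms.

Lemma admissible_fieldW (K : realType) m (t0 : K) (Omega : set 'cV[K]_m) x0 r C L C' L' h :
  C <= C' -> L <= L' ->
  admissible_field t0 Omega x0 r C L h -> admissible_field t0 Omega x0 r C' L' h.
Proof.
move=> CC LL [c b l]; split=> //.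
  by move=> x s xr ts; apply: le_trans (b _ _ xr ts) CC.
move=> x x' s xr Ox ts; apply: le_trans (l _ _ _ xr Ox ts) _.
exact: ler_wpM2r.
Qed.

(** * The Maxey--Riley system as a Volterra equation *)
Section MaxeyRiley.
Context (K : realType) (n : nat) (D : set 'cV[K]_n) (u : 'cV[K]_n * K -> 'cV[K]_n).
Context (p : mr_params K n).
Context (t0 : K) (ht0 : 0 <= t0) (hu : regular_velocity D u).
Local Notation E := 'cV[K]_(n + n).

Definition phase_space : set E := [set x | D (usubmx x)].

(** The phase variable is [x = col_mx y w]; the drift gathers the terms without
    kernel, and the memory field is what the kernel [1 / sqrt (t - s)] multiplies. *)
Definition mr_drift (x : E) (s : K) : E :=
  let y := usubmx x in let w := dsubmx x in
  col_mx (w + A_u p u (y, s))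
    (- (mr_mu p *: w) - M_u p u (y, s) *m w + B_u p u (y, s)).

Definition mr_memory (x : E) (s : K) : E :=
  col_mx 0 (- ((mr_kappa p * Num.sqrt (mr_mu p)) *: dsubmx x)).

Lemma mild_solutionP d y0 w0 (X : K -> E) :
  mild_solution p D u t0 d y0 w0 (usubmx \o X) (dsubmx \o X) <->
  volterra_solution t0 phase_space (col_mx y0 w0) mr_drift mr_memory d X.
Proof.
have eqn t : volterra_map t0 (col_mx y0 w0) mr_drift mr_memory X t =
    col_mx (y0 + vint t0 t (fun s => dsubmx (X s) + A_u p u (usubmx (X s), s)))
      (w0 + vint t0 t (fun s =>
           - (mr_mu p *: dsubmx (X s)) - M_u p u (usubmx (X s), s) *m dsubmx (X s)
           - (mr_kappa p * Num.sqrt (mr_mu p) / Num.sqrt (t - s)) *: dsubmx (X s)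
           + B_u p u (usubmx (X s), s))).
  rewrite -add_col_mx -vint_col_mx; congr (_ + _).
  apply: eq_vint => s _; rewrite /mr_drift /mr_memory scale_col_mx add_col_mx.
  congr col_mx; first by rewrite scaler0 addr0.
  rewrite scalerN scalerA [abel_kernel _ * _]mulrC /abel_kernel.
  by rewrite -[LHS]addrA -[RHS]addrA; congr (_ + _); rewrite addrC.
split.
- move=> [cy cw Dy ey ew]; split.
  + have -> : X = fun s => col_mx ((usubmx \o X) s) ((dsubmx \o X) s).
      by apply/funext => s; rewrite /= vsubmxK.
    exact: (within_continuous_col_mx cy cw).
  + exact: Dy.
  + move=> t tI; rewrite eqn -[LHS]vsubmxK; congr col_mx; [exact: ey|exact: ew].
- move=> [cX OX eX].
  have cu : continuous (@usubmx K n n 1).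
    by apply: contractive_continuous => x y; rewrite -linearB; exact: norm_usubmx_le.
  have cd : continuous (@dsubmx K n n 1).
    by apply: contractive_continuous => x y; rewrite -linearB; exact: norm_dsubmx_le.
  split.
  + move=> s; apply: (@continuous_comp (subspace `[t0, t0 + d]) _ _ X usubmx).
      exact: cX.
    exact: cu.
  + move=> s; apply: (@continuous_comp (subspace `[t0, t0 + d]) _ _ X dsubmx).
      exact: cX.
    exact: cd.
  + exact: OX.
  + by move=> t tI; rewrite /= eX// eqn col_mxKu.
  + by move=> t tI; rewrite /= eX// eqn col_mxKd.
Qed.

Local Notation S := (phase_space `*` [set s | t0 <= s]).

Lemma bounded_lipschitz_along (V : normedModType K) (F : 'cV[K]_n * K -> V) R :
  bounded_lipschitz (spacetime D) F ->
  bounded_lipschitz (S `&` [set z | `|z.1| <= R]) (fun z => F (usubmx z.1, z.2)).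
Proof.
apply: bounded_lipschitz_comp => [z [[Dz tz] _]|z z'].
  by split => //; exact: le_trans tz.
rewrite [leLHS]prod_normE [leRHS]prod_normE ge_max !le_max lexx orbT andbT /=.
by rewrite -linearB norm_usubmx_le.
Qed.

Lemma bounded_lipschitz_dsubmx R :
  bounded_lipschitz (S `&` [set z | `|z.1| <= R]) (fun z => dsubmx z.1).
Proof.
exists (Num.max R 1); split; first by rewrite le_max ler01 orbT.
  move=> z [_ zR]; apply: le_trans (norm_dsubmx_le _) _.
  by rewrite le_max zR.
move=> z z' _ _; apply: (@le_trans _ _ `|z - z'|).
  rewrite -linearB; apply: le_trans (norm_dsubmx_le _) _.
  by rewrite [leRHS]prod_normE le_max lexx.
by rewrite ler_peMl// le_max lexx orbT.
Qed.

Lemma bounded_lipschitz_drift R :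
  bounded_lipschitz (S `&` [set z | `|z.1| <= R]) (fun z => mr_drift z.1 z.2).
Proof.
apply: bounded_lipschitz_col_mx.
  by apply: bounded_lipschitzD; [exact: bounded_lipschitz_dsubmx|
    exact/bounded_lipschitz_along/bounded_lipschitz_A_u].
apply: bounded_lipschitzD; last exact/bounded_lipschitz_along/bounded_lipschitz_B_u.
apply: bounded_lipschitzB.
  apply: (@eq_bounded_lipschitz _ _ _ _ (fun z => (- mr_mu p) *: dsubmx z.1)).
    by move=> z _; rewrite scaleNr.
  by apply: bounded_lipschitzZ; exact: bounded_lipschitz_dsubmx.
by apply: bounded_lipschitz_mulmx; [
  exact/bounded_lipschitz_along/bounded_lipschitz_M_u|
  exact: bounded_lipschitz_dsubmx].
Qed.

Lemma bounded_lipschitz_memory R :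
  bounded_lipschitz (S `&` [set z | `|z.1| <= R]) (fun z => mr_memory z.1 z.2).
Proof.
apply: bounded_lipschitz_col_mx; first exact: bounded_lipschitz_cst.
apply: (@eq_bounded_lipschitz _ _ _ _
   (fun z => (- (mr_kappa p * Num.sqrt (mr_mu p))) *: dsubmx z.1)).
  by move=> z _; rewrite scaleNr.
by apply: bounded_lipschitzZ; exact: bounded_lipschitz_dsubmx.
Qed.

Section Ball.
Context (x0 : E) (r : K).
Hypothesis ball_phase : forall x, `|x - x0| <= r -> phase_space x.

Lemma admissible_of_bounded_lipschitz h L :
  (forall R, bounded_lipschitz (S `&` [set z | `|z.1| <= R]) (fun z => h z.1 z.2)) ->
  (forall x x' s, `|x - x0| <= r -> phase_space x' -> t0 <= s ->
     `|h x s - h x' s| <= L * `|x - x'|) ->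
  exists C, admissible_field t0 phase_space x0 r C L h.
Proof.
move=> bh lh; have [C [C0 b _]] := bh (r + `|x0|).
exists C; split => //; first exact: locally_lipschitz_continuous.
move=> x s xr ts; apply: (b (x, s)); split; first by split => //; exact: ball_phase.
rewrite /= -[x](subrK x0); apply: le_trans (ler_normD _ _) _.
by rewrite lerD2r.
Qed.

(** The critical term [M(y) w] is handled by [norm_mulmxB_le]: the factor [M(y')]
    is bounded on all of space-time and [w], being in the ball, is bounded, so
    that no bound on [w'] enters. *)
Lemma mr_drift_admissible : exists C L, 0 <= L /\
  admissible_field t0 phase_space x0 r C L mr_drift.
Proof.
have [CA [CA0 _ lA]] := bounded_lipschitz_A_u hu p.
have [CM [CM0 bM lM]] := bounded_lipschitz_M_u hu p.
have [CB [CB0 _ lB]] := bounded_lipschitz_B_u hu p.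
(* [W] bounds [w] on the ball, [Q] is the Lipschitz constant of [M(y) w]; the
   factor [n] comes from matrix products in the sup norm. *)
pose W := r + `|x0|.
pose Q := n%:R * CM + n%:R * CM * `|W|.
have Q0 : 0 <= Q by rewrite addr_ge0// !mulr_ge0.
pose L := (1 + CA) + (`|mr_mu p| + Q + CB).
have up0 : 0 <= 1 + CA by rewrite addr_ge0.
have low0 : 0 <= `|mr_mu p| + Q + CB by rewrite (addr_ge0 (addr_ge0 _ Q0) CB0).
have L0 : 0 <= L by exact: addr_ge0.
suff lip x x' s : `|x - x0| <= r -> phase_space x' -> t0 <= s ->
    `|mr_drift x s - mr_drift x' s| <= L * `|x - x'|.
  have [C aC] := admissible_of_bounded_lipschitz bounded_lipschitz_drift lip.
  by exists C, L.
move=> xr Ox' ts.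
have Ox := ball_phase xr.
have s0 : 0 <= s by exact: le_trans ts.
set y := usubmx x; set w := dsubmx x; set y' := usubmx x'; set w' := dsubmx x'.
have yy : `|(y, s) - (y', s)| <= `|x - x'|.
  rewrite [leLHS]prod_normE /= subrr normr0 ge_max normr_ge0 andbT.
  by rewrite -linearB norm_usubmx_le.
have ww : `|w - w'| <= `|x - x'| by rewrite -linearB norm_dsubmx_le.
have wW : `|w| <= `|W|.
  apply: le_trans (norm_dsubmx_le _) _; apply: le_trans (ler_norm W).
  by rewrite -[x](subrK x0); apply: le_trans (ler_normD _ _) _; rewrite lerD2r.
have Sy : spacetime D (y, s) by split.
have Sy' : spacetime D (y', s) by split.
have lip2 (V : normedModType K) (F : 'cV[K]_n * K -> V) C : 0 <= C ->
    (forall z z', spacetime D z -> spacetime D z' -> `|F z - F z'| <= C * `|z - z'|) ->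
    `|F (y, s) - F (y', s)| <= C * `|x - x'|.
  by move=> C0 l; apply: le_trans (l _ _ Sy Sy') _; exact: ler_wpM2l.
have hA := lip2 _ _ _ CA0 lA; have hM := lip2 _ _ _ CM0 lM; have hB := lip2 _ _ _ CB0 lB.
have hMw : `|M_u p u (y, s) *m w - M_u p u (y', s) *m w'| <= Q * `|x - x'|.
  apply: le_trans (norm_mulmxB_le _ _ _ _) _; rewrite [leRHS]mulrDl.
  apply: lerD; rewrite -!mulrA ler_wpM2l//.
    by apply: ler_pM => //; exact: bM.
  by rewrite [`|W| * _]mulrC mulrA; apply: ler_pM.
rewrite /mr_drift -/y -/w -/y' -/w' opp_col_mx add_col_mx.
have a0 : 0 <= `|x - x'| by [].
apply/norm_col_mx_leP; split.
  rewrite opprD addrACA; apply: le_trans (ler_normD _ _) _.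
  apply: (@le_trans _ _ ((1 + CA) * `|x - x'|)); first by rewrite mulrDl mul1r lerD.
  by rewrite ler_wpM2r// lerDl.
apply: (@le_trans _ _ ((`|mr_mu p| + Q + CB) * `|x - x'|)); last first.
  by rewrite ler_wpM2r// lerDr.
rewrite opprD addrACA; apply: le_trans (ler_normD _ _) _; rewrite mulrDl lerD//.
rewrite opprD addrACA; apply: le_trans (ler_normD _ _) _; rewrite mulrDl lerD//.
  by rewrite -opprD normrN -scalerBr normrZ ler_wpM2l.
by rewrite -opprD normrN.
Qed.

Lemma mr_memory_admissible : exists C L, 0 <= L /\
  admissible_field t0 phase_space x0 r C L mr_memory.
Proof.
pose c := mr_kappa p * Num.sqrt (mr_mu p).
suff lip x x' s : `|x - x0| <= r -> phase_space x' -> t0 <= s ->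
    `|mr_memory x s - mr_memory x' s| <= `|c| * `|x - x'|.
  have [C aC] := admissible_of_bounded_lipschitz bounded_lipschitz_memory lip.
  by exists C, `|c|.
move=> _ _ _; rewrite /mr_memory opp_col_mx add_col_mx.
apply/norm_col_mx_leP; split; first by rewrite subrr normr0 mulr_ge0.
rewrite -opprD normrN -scalerBr normrZ ler_wpM2l//.
by rewrite -linearB norm_dsubmx_le.
Qed.
End Ball.
End MaxeyRiley.

Theorem theorem1 (K : realType) (n : nat) (hn : n = 2%N \/ n = 3%N)
  (D : set 'cV[K]_n) (hD : open D) (u : 'cV[K]_n * K -> 'cV[K]_n)
  (p : mr_params K n)
  (hf : 0 < rho_f p) (hp : 0 < rho_p p)
  (hSt : 0 < Stokes p) (hRe : 0 < Reynolds p)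
  (t0 : K) (ht0 : 0 <= t0)
  (hu : regular_velocity D u) (y0 w0 : 'cV[K]_n) (hy0 : D y0) :
  exists delta : K, 0 < delta /\
  exists y w : K -> 'cV[K]_n,
    [/\ mild_solution p D u t0 delta y0 w0 y w,
        y t0 = y0 /\ w t0 = w0,
        (forall y' w' : K -> 'cV[K]_n,
           mild_solution p D u t0 delta y0 w0 y' w' ->
           forall t : K, t0 <= t <= t0 + delta -> y' t = y t /\ w' t = w t)
      & mild_position p D u t0 delta y0 w0 y].
Proof.
have /nbhs_ballP[e /= e0 eD] : nbhs y0 D by exact: open_nbhs_nbhs.
(* Half the radius: the norm condition defining the closed ball is not strict. *)
pose r := e / 2; have r0 : 0 < r by rewrite divr_gt0.
pose x0 := col_mx y0 w0.
have ballO x : `|x - x0| <= r -> phase_space D x.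
  move=> xr; apply: eD; rewrite -ball_normE/= distrC.
  apply: (@le_lt_trans _ _ r); last by rewrite ltr_pdivrMr// ltr_pMr// ltr1n.
  apply: le_trans xr; apply: le_trans (norm_usubmx_le _).
  by rewrite linearB/= col_mxKu.
have [C1 [L1 [L10 a1]]] := mr_drift_admissible p ht0 hu ballO.
have [C2 [L2 [L20 a2]]] := mr_memory_admissible p t0 ballO.
have [] := @volterra_wellposed K _ t0 (phase_space D) x0 r (mr_drift u p) (mr_memory p)
  r0 ballO (Num.max C1 C2) (Num.max L1 L2).
- by rewrite le_max L10.
- by apply: admissible_fieldW a1; rewrite le_max lexx.
- by apply: admissible_fieldW a2; rewrite le_max lexx orbT.
move=> d d0 [X sX uX]; exists d; split => //.
have mX := (mild_solutionP D u p t0 d y0 w0 X).2 sX.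
have t0I : t0 <= t0 <= t0 + d by rewrite lexx lerDl ltW.
exists (usubmx \o X), (dsubmx \o X); split => //.
- have [_ _ _ ey ew] := mX.
  by rewrite ey// ew// !vintxx !addr0.
- move=> y' w' m' t tI.
  have := uX (fun s => col_mx (y' s) (w' s)) _ t tI.
  move=> /= <-; first by rewrite col_mxKu col_mxKd.
  apply/mild_solutionP.
  rewrite (_ : usubmx \o _ = y'); last by apply/funext => s; rewrite /= col_mxKu.
  by rewrite (_ : dsubmx \o _ = w')//; apply/funext => s; rewrite /= col_mxKd.
- by exists (dsubmx \o X).
Qed.
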